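(* Let $f:\mathbb{R}^n\to\mathbb{R}$ be differentiable with optimal value $f^*=\inf_x f(x)>-\infty$, let $\mathcal{B}$ be the set of available blocks, and for each $b\in\mathcal{B}$ let $H_b\in\mathbb{R}^{|b|\times|b|}$ be a symmetric positive-definite matrix. Assume that $\nabla f$ is Lipschitz continuous with respect to the matrices $H_b$, i.e. for every $b\in\mathcal{B}$, $x\in\mathbb{R}^n$ and $d\in\mathbb{R}^{|b|}$, $$\|\nabla_b f(x+U_b d)-\nabla_b f(x)\|_{H_b^{-1}}\le \|d\|_{H_b}.$$ Assume also that $f$ satisfies the Polyak-Łojasiewicz inequality with some constant $\mu>0$ in the norm $\|v\|_{\mathcal{B}}=\max_{b\in\mathcal{B}}\|v_b\|_{H_b^{-1}}$, i.e. $\frac12\|\nabla f(x)\|_{\mathcal{B}}^2\ge\mu(f(x)-f^* )$ for all $x\in\mathbb{R}^n$. Then the block coordinate descent method using either the GSQ, GSL, GSD or GS selection rule (the last three corresponding to the specific choices of $H_b$ described in the context) satisfies, for all $k\ge 0$, $$f(x^{k+1})-f^*\le(1-\mu)^k\,[f(x^0)-f^*].$$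
   Context: Blocks: $\mathcal{B}$ is a finite collection of nonempty subsets of $\{1,\dots,n\}$ whose union is $\{1,\dots,n\}$ (for example a fixed partition, or all subsets of a given size). For $b\in\mathcal{B}$, $U_b\in\{0,1\}^{n\times|b|}$ consists of the columns of the identity matrix indexed by $b$; $v_b=U_b^Tv$, and $\nabla_b f(x)=U_b^T\nabla f(x)$. For positive-definite $H$, $\|v\|_H=\sqrt{v^THv}$. Block coordinate descent (BCD) method: from $x^0\in\mathbb{R}^n$, at iteration $k$ a block $b_k\in\mathcal{B}$ is chosen and $$x^{k+1}=x^k-U_{b_k}H_{b_k}^{-1}\nabla_{b_k}f(x^k).$$ Selection rules (ties broken arbitrarily): - GSQ (block Gauss-Southwell-Quadratic): $b_k\in\arg\max_{b\in\mathcal{B}}\|\nabla_b f(x^k)\|_{H_b^{-1}}$, for general positive-definite $H_b$. - GSD (block Gauss-Southwell-Diagonal): the GSQ rule with $H_b=D_b$ diagonal with positive diagonal entries, so $b_k\in\arg\max_{b}\sum_{i\in b}|\nabla_i f(x^k)|^2/D_{b,i}$. - GSL (block Gauss-Southwell-Lipschitz): the GSQ rule with $H_b=L_bI$ for constants $L_b>0$, so $b_k\in\arg\max_b \|\nabla_b f(x^k)\|^2/L_b$. - GS (block Gauss-Southwell): the GSQ rule with $H_b=LI$ for a constant $L>0$ common to all blocks, so $b_k\in\arg\max_b\|\nabla_b f(x^k)\|$. In each case the same matrices $H_b$ are used in the Lipschitz assumption, the norm $\|\cdot\|_{\mathcal{B}}$, the selection rule and the update. *)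

(* Defs.v *)
From HB Require Import structures.
From mathcomp Require Export all_boot all_order all_algebra.
From mathcomp Require Export boolp classical_sets reals topology normedtype derive.

Set Implicit Arguments.
Unset Strict Implicit.
Unset Printing Implicit Defensive.

Import Order.TTheory GRing.Theory Num.Theory.
Export numFieldNormedType.Exports.

Local Open Scope ring_scope.

(* The canonical norm `|v| on 'cV[R]_n is the max norm, hence l2norm. *)
Definition l2norm (R : realType) (m : nat) (v : 'cV[R]_m) : R :=
  Num.sqrt (\sum_i v i 0 ^+ 2).

Definition quad_form (R : realType) (m : nat) (H : 'M[R]_m) (v : 'cV[R]_m) : R :=
  (v^T *m H *m v) 0 0.

Definition sym_posdef (R : realType) (m : nat) (H : 'M[R]_m) : Prop :=
  H^T = H /\ forall v : 'cV[R]_m, v != 0 -> 0 < quad_form H v.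

Definition normH (R : realType) (m : nat) (H : 'M[R]_m) (v : 'cV[R]_m) : R :=
  Num.sqrt (quad_form H v).

Definition grad (R : realType) (n : nat) (f : 'cV[R]_n -> R) (x : 'cV[R]_n) :
  'cV[R]_n := \col_i 'D_(delta_mx i 0) f x.

Definition optval (R : realType) (n : nat) (f : 'cV[R]_n -> R) : R :=
  inf (range f)%classic.

Definition block_collection (n : nat) (B : {set {set 'I_n}}) : Prop :=
  finset.set0 \notin B /\ finset.cover B = finset.setT.

(* The elements of b are listed in increasing order by enum_val : 'I_#|b| -> 'I_n. *)
Definition Ublk (R : realType) (n : nat) (b : {set 'I_n}) : 'M[R]_(n, #|b|) :=
  colsub (fun j : 'I_#|b| => enum_val j) 1%:M.

Definition blk (R : realType) (n : nat) (b : {set 'I_n}) (v : 'cV[R]_n) :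
  'cV[R]_#|b| := (Ublk R b)^T *m v.

Definition block_lipschitz (R : realType) (n : nat) (B : {set {set 'I_n}})
    (H : forall b : {set 'I_n}, 'M[R]_#|b|) (f : 'cV[R]_n -> R) : Prop :=
  forall (b : {set 'I_n}) (x : 'cV[R]_n) (d : 'cV[R]_#|b|), b \in B ->
    normH (invmx (H b))
      (blk b (grad f (x + Ublk R b *m d)) - blk b (grad f x)) <= normH (H b) d.

(* The base value 0 is harmless: the norms are nonnegative, and B is nonempty
   when it covers a nonempty index set. *)
Definition block_norm (R : realType) (n : nat) (B : {set {set 'I_n}})
    (H : forall b : {set 'I_n}, 'M[R]_#|b|) (v : 'cV[R]_n) : R :=
  \big[Num.max/0]_(b in B) normH (invmx (H b)) (blk b v).

Definition PL_inequality (R : realType) (n : nat) (B : {set {set 'I_n}})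
    (H : forall b : {set 'I_n}, 'M[R]_#|b|) (f : 'cV[R]_n -> R) (mu : R) : Prop :=
  forall x : 'cV[R]_n,
    mu * (f x - optval f) <= 2^-1 * block_norm B H (grad f x) ^+ 2.

Definition bcd_step (R : realType) (n : nat)
    (H : forall b : {set 'I_n}, 'M[R]_#|b|) (f : 'cV[R]_n -> R)
    (b : {set 'I_n}) (x : 'cV[R]_n) : 'cV[R]_n :=
  x - Ublk R b *m (invmx (H b) *m blk b (grad f x)).

Definition is_argmax (R : realType) (n : nat) (B : {set {set 'I_n}})
    (score : {set 'I_n} -> R) (b : {set 'I_n}) : Prop :=
  b \in B /\ forall b', b' \in B -> score b' <= score b.

(* In the selection rules below g is the current gradient and b the selected
   block. *)
Definition GSQ (R : realType) (n : nat) (B : {set {set 'I_n}})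
    (H : forall b : {set 'I_n}, 'M[R]_#|b|) (g : 'cV[R]_n) (b : {set 'I_n}) : Prop :=
  is_argmax B (fun b => normH (invmx (H b)) (blk b g)) b.

Definition GSD (R : realType) (n : nat) (B : {set {set 'I_n}})
    (D : {set 'I_n} -> 'I_n -> R) (g : 'cV[R]_n) (b : {set 'I_n}) : Prop :=
  is_argmax B (fun b => \sum_(i in b) `|g i 0| ^+ 2 / D b i) b.

Definition GSL (R : realType) (n : nat) (B : {set {set 'I_n}})
    (L : {set 'I_n} -> R) (g : 'cV[R]_n) (b : {set 'I_n}) : Prop :=
  is_argmax B (fun b => l2norm (blk b g) ^+ 2 / L b) b.

Definition GS (R : realType) (n : nat) (B : {set {set 'I_n}})
    (g : 'cV[R]_n) (b : {set 'I_n}) : Prop :=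
  is_argmax B (fun b => l2norm (blk b g)) b.

(* D b i is only relevant for i in b. *)
Definition diag_blocks (R : realType) (n : nat) (B : {set {set 'I_n}})
    (D : {set 'I_n} -> 'I_n -> R) (H : forall b : {set 'I_n}, 'M[R]_#|b|) : Prop :=
  forall b, b \in B ->
    (forall i, i \in b -> 0 < D b i) /\ H b = diag_mx (\row_j D b (enum_val j)).

(* Main.v *)
(* Minimizing the quadratic upper model given by the block Lipschitz condition
   shows that one step decreases f by at least half the squared dual norm of the
   block gradient. GSL, GSD and GS are the GSQ rule for scalar or diagonal H_b,
   and the GSQ block attains the norm of the Polyak-Lojasiewicz inequality, so
   the gap to the optimal value contracts by the factor 1 - mu. *)
Require Import Defs.
From mathcomp Require Import ring lra.

Import Order.TTheory GRing.Theory Num.Theory.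

Local Open Scope ring_scope.

(** * Duality between the norms of [H] and its inverse *)

Section QuadraticForms.
Context {R : realType} {m : nat}.
Implicit Types (H : 'M[R]_m) (u v w d : 'cV[R]_m).

Lemma quad_form_ge0 H v : sym_posdef H -> 0 <= quad_form H v.
Proof.
move=> [_ Hpos]; have [->|/Hpos/ltW//] := eqVneq v 0.
by rewrite /quad_form mulmx0 mxE.
Qed.

Lemma sym_posdef_unitmx H : sym_posdef H -> H \in unitmx.
Proof.
move=> [_ Hpos]; rewrite unitmxE unitfE; apply/det0P => -[v v0 vH].
have : 0 < quad_form H v^T by apply: Hpos; rewrite trmx_eq0.
by rewrite /quad_form trmxK vH mul0mx mxE ltxx.
Qed.

Lemma quad_formZ H a v : quad_form H (a *: v) = a ^+ 2 * quad_form H v.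
Proof.
by rewrite /quad_form [(a *: v)^T]linearZ /= -!scalemxAl -scalemxAr scalerA mxE expr2.
Qed.

Lemma quad_formN H v : quad_form H (- v) = quad_form H v.
Proof. by rewrite -scaleN1r quad_formZ sqrrN expr1n mul1r. Qed.

(** This identity carries nonnegativity over to [invmx H] and evaluates the quadratic model at the
    step [invmx H *m w]. *)
Lemma quad_form_invmx H w : sym_posdef H ->
  quad_form H (invmx H *m w) = quad_form (invmx H) w.
Proof.
move=> Hpd; have HU := sym_posdef_unitmx H Hpd; case: Hpd => HT _.
by rewrite /quad_form trmx_mul trmx_inv HT -!mulmxA mulKVmx.
Qed.

Lemma quad_form_invmx_ge0 H w : sym_posdef H -> 0 <= quad_form (invmx H) w.
Proof.
by move=> Hpd; rewrite -quad_form_invmx//; exact: quad_form_ge0.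
Qed.

(* Young's inequality for the pair of dual norms attached to H and H^-1:
   expand 0 <= ||H^-1 w - t d||_H^2. *)
Lemma dual_young H (t : R) w d : sym_posdef H ->
  2 * t * (w^T *m d) 0 0 <= quad_form (invmx H) w + t ^+ 2 * quad_form H d.
Proof.
move=> Hpd; have HU := sym_posdef_unitmx H Hpd; have [HT _] := Hpd.
have := quad_form_ge0 H (invmx H *m w - t *: d) Hpd.
have -> : quad_form H (invmx H *m w - t *: d) =
    quad_form (invmx H) w - 2 * t * (w^T *m d) 0 0 + t ^+ 2 * quad_form H d.
  rewrite -quad_formZ -(quad_form_invmx H w Hpd) /quad_form.
  set u := invmx H *m w; set z := t *: d.
  have Hu : H *m u = w by rewrite mulKVmx.
  have uH : u^T *m H = w^T by rewrite -Hu [(H *m u)^T]trmx_mul HT.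
  have zw : (z^T *m w) 0 0 = (w^T *m z) 0 0.
    by rewrite -[w in z^T *m w]trmxK -trmx_mul mxE.
  have wz : (w^T *m z) 0 0 = t * (w^T *m d) 0 0.
    by rewrite -scalemxAr mxE.
  rewrite [(u - z)^T]linearB /= mulmxBl mulmxBr !mulmxBl uH -(mulmxA z^T H u) Hu !mxE.
  move: zw wz; rewrite !mxE => -> ->.
  ring.
lra.
Qed.

End QuadraticForms.

(** * Directional derivatives and restriction to a line *)

Section Gradient.
Context {R : realType} {n : nat}.
Implicit Types (f : 'cV[R]_n -> R) (x v : 'cV[R]_n).

Lemma derive_grad f x v : differentiable f x ->
  'D_v f x = ((grad f x)^T *m v) 0 0.
Proof.
move=> fx; rewrite deriveE// {1}(matrix_sum_delta v) linear_sum /= mxE.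
apply: eq_bigr => i _; rewrite big_ord1 linearZ /= !mxE deriveE//.
by rewrite mulrC.
Qed.

Lemma is_derive_line f x v (t : R) : differentiable f (x + t *: v) ->
  is_derive t 1 (fun s => f (x + s *: v)) (((grad f (x + t *: v))^T *m v) 0 0).
Proof.
move=> fx; rewrite -derive_grad//.
(* The difference quotient in [t] is the one defining the derivative at [x + t *: v] in direction
   [v]. *)
have E : (fun h : R => h^-1 *: (f (x + (h *: 1 + t) *: v) - f (x + t *: v))) =
         (fun h : R => h^-1 *: (f (h *: v + (x + t *: v)) - f (x + t *: v))).
  by apply/funext => h; rewrite [h *: 1]mulr1 scalerDl addrCA.
apply: DeriveDef; last by rewrite /derive /= E.
have := @diff_derivable _ _ _ _ _ v fx.
by rewrite /derivable /= E.
Qed.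

End Gradient.

(** * Quadratic upper model and decrease in one step *)

Section Descent.
Context {R : realType} {n : nat} {B : {set {set 'I_n}}}
  {H : forall b : {set 'I_n}, 'M[R]_#|b|} {f : 'cV[R]_n -> R}.
Hypothesis f_diff : forall y : 'cV[R]_n, differentiable f y.
Hypothesis H_posdef : forall c : {set 'I_n}, c \in B -> sym_posdef (H c).
Hypothesis f_lip : block_lipschitz B H f.

(** The gap [psi] between [f] along the segment and its quadratic model has nonpositive derivative
    inside the unit interval, so the mean value theorem gives [psi 1 <= psi 0]. *)
Lemma block_descent (c : {set 'I_n}) x (d : 'cV[R]_#|c|) : c \in B ->
  f (x + Ublk R c *m d) <=
  f x + ((blk c (grad f x))^T *m d) 0 0 + 2^-1 * quad_form (H c) d.
Proof.
move=> cB; have Hc := H_posdef c cB.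
set v := Ublk R c *m d; set q := quad_form _ d.
set l := ((blk c (grad f x))^T *m d) 0 0.
have q0 : 0 <= q by exact: quad_form_ge0.
have dotE y : ((grad f y)^T *m v) 0 0 = ((blk c (grad f y))^T *m d) 0 0.
  by rewrite /blk trmx_mul trmxK mulmxA.
pose psi (t : R) := f (x + t *: v) - (t * l + t ^+ 2 * (2^-1 * q)).
pose dpsi (t : R) := ((grad f (x + t *: v))^T *m v) 0 0 - (l + t * q).
have psiD (t : R) : is_derive t 1 psi (dpsi t).
  have fD := is_derive_line f x v t (f_diff _).
  apply: is_derive_eq; rewrite /dpsi.
  rewrite !scaler0 !add0r [l%:A]mulr1 [t%:A]mulr1.
  have tq : 2^-1 * q * (t + t) = t * q by field.
  by congr (_ - (_ + _)); exact: tq.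
have [c0 /[!in_itv]/= /andP[c0_gt0 c0_lt1] psiE] : exists2 t : R, t \in `]0, 1[%R &
    psi 1 - psi 0 = dpsi t * (1 - 0).
  apply: MVT => //.
  apply: derivable_within_continuous => t _; exact: ex_derive.
suff dle : dpsi c0 <= 0.
  move: psiE; rewrite subr0 mulr1 /psi scale1r scale0r addr0 expr1n expr0n /=.
  lra.
rewrite /dpsi dotE.
set w := blk c (grad f (x + c0 *: v)) - blk c (grad f x).
have -> : ((blk c (grad f (x + c0 *: v)))^T *m d) 0 0 = (w^T *m d) 0 0 + l.
  by rewrite [w^T]linearB /= mulmxBl [X in X + l]mxE [X in _ + X + l]mxE subrK.
(* The Lipschitz condition for the displacement [c0 *: d], with both sides squared. *)
have wq : quad_form (invmx (H c)) w <= c0 ^+ 2 * q.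
  have := f_lip c x (c0 *: d) cB; rewrite -scalemxAr -/v -/w /normH.
  by rewrite ler_sqrt quad_formZ// mulr_ge0// sqr_ge0.
(* The weight [c0] balances Young's inequality: both right-hand terms are at most [c0 ^+ 2 * q], and
   dividing by [2 * c0 > 0] leaves the bound [c0 * q]. *)
have yw := dual_young (H c) c0 w d Hc.
have : c0 * (w^T *m d) 0 0 <= c0 * (c0 * q) by rewrite -/q in yw; lra.
rewrite ler_pM2l//; lra.
Qed.

(** At [d = - H^-1 g] the linear term of the model is minus the squared dual norm of [g] and the
    quadratic term is half of it. *)
Lemma bcd_step_descent (c : {set 'I_n}) x : c \in B ->
  f (bcd_step H f c x) <=
  f x - 2^-1 * normH (invmx (H c)) (blk c (grad f x)) ^+ 2.
Proof.
move=> cB; have Hc := H_posdef c cB.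
set g := blk c _; have := block_descent c x (- (invmx (H c) *m g)) cB.
rewrite mulmxN -/g quad_formN quad_form_invmx// mulmxN mxE (mulmxA g^T) -/(quad_form _ _).
rewrite /bcd_step -/g /normH sqr_sqrtr ?quad_form_invmx_ge0//; lra.
Qed.

End Descent.

(** * Reduction of the selection rules to GSQ *)

Section SelectionRules.
Context {R : realType} {n : nat}.
Implicit Types (B : {set {set 'I_n}}) (c : {set 'I_n}) (g : 'cV[R]_n).

Lemma quad_form_diag m (r : 'rV[R]_m) v :
  quad_form (diag_mx r) v = \sum_i r 0 i * v i 0 ^+ 2.
Proof.
rewrite /quad_form -mulmxA mul_diag_mx mxE; apply: eq_bigr => i _.
by rewrite !mxE expr2 mulrCA.
Qed.

Lemma invmx_diag m (r : 'rV[R]_m) : (forall i, r 0 i != 0) ->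
  invmx (diag_mx r) = diag_mx (\row_i (r 0 i)^-1).
Proof.
move=> r0; have rV : diag_mx r *m diag_mx (\row_i (r 0 i)^-1) = 1%:M.
  rewrite mulmx_diag -diag_const_mx; congr diag_mx; apply/rowP => i.
  by rewrite !mxE divff.
have [rU _] := mulmx1_unit rV.
by rewrite -[RHS](mulKmx rU) rV mulmx1.
Qed.

Lemma blkE c g j : blk c g j 0 = g (enum_val j) 0.
Proof.
rewrite /blk mxE (bigD1 (enum_val j))//= !mxE eqxx mul1r big1 ?addr0// => i ij.
by rewrite !mxE (negPf ij) mul0r.
Qed.

(** An argmax depends only on the order of the scores, so squares, roots and positive factors can be
    exchanged. *)
Lemma argmax_mono B (s s' : {set 'I_n} -> R) c :
  (forall a a', a \in B -> a' \in B -> s a <= s a' -> s' a <= s' a') ->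
  is_argmax B s c -> is_argmax B s' c.
Proof. by move=> ss' [cB cmax]; split=> // a aB; apply: ss' => //; exact: cmax. Qed.

(** The GSD score is the square of the GSQ score. *)
Lemma GSD_GSQ B (D : {set 'I_n} -> 'I_n -> R) (H : forall c, 'M[R]_#|c|) g c : diag_blocks B D H ->
  GSD B D g c -> GSQ B H g c.
Proof.
move=> BD; have E (a : {set 'I_n}) : a \in B ->
    \sum_(i in a) `|g i 0| ^+ 2 / D a i = quad_form (invmx (H a)) (blk a g).
  move=> /BD[D0 ->]; rewrite invmx_diag => [|j]; last first.
    by rewrite mxE gt_eqF// D0// enum_valP.
  rewrite quad_form_diag big_enum_val; apply: eq_bigr => j _.
  by rewrite blkE !mxE real_normK ?num_real// mulrC.
by apply: argmax_mono => a a' aB a'B; rewrite !E//; exact: ler_wsqrtr.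
Qed.

(** This is GSD with [D] constant on each block. *)
Lemma GSL_GSQ B (L : {set 'I_n} -> R) (H : forall c, 'M[R]_#|c|) g c :
  (forall a, a \in B -> 0 < L a /\ H a = (L a)%:M) ->
  GSL B L g c -> GSQ B H g c.
Proof.
move=> BL [cB cmax]; apply: (@GSD_GSQ _ (fun a _ => L a)).
  move=> a /BL[La ->]; split=> //; rewrite -diag_const_mx.
  by congr diag_mx; apply/rowP => j; rewrite !mxE.
have E (a : {set 'I_n}) :
    \sum_(i in a) `|g i 0| ^+ 2 / L a = l2norm (blk a g) ^+ 2 / L a.
  rewrite /l2norm sqr_sqrtr; last by apply: sumr_ge0 => i _; exact: sqr_ge0.
  rewrite -mulr_suml big_enum_val; congr (_ / _); apply: eq_bigr => j _.
  by rewrite blkE real_normK ?num_real.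
by split=> // a aB; rewrite !E; exact: cmax.
Qed.

Lemma GS_GSQ B (L : R) (H : forall c, 'M[R]_#|c|) g c : 0 < L ->
  (forall a, a \in B -> H a = L%:M) -> GS B g c -> GSQ B H g c.
Proof.
move=> L0 BL cmax; apply: (@GSL_GSQ _ (fun=> L)); first by move=> a /BL.
apply: argmax_mono cmax => a a' _ _ aa'.
by rewrite ler_pM2r ?invr_gt0// lerXn2r// nnegrE sqrtr_ge0.
Qed.

(** This transfers the Polyak-Lojasiewicz bound to the selected block; the base value 0 of the
    maximum is covered by nonnegativity of the norm. *)
Lemma GSQ_block_norm B (H : forall c, 'M[R]_#|c|) g c : GSQ B H g c ->
  block_norm B H g <= normH (invmx (H c)) (blk c g).
Proof. by move=> [_ cmax]; apply: bigmax_le => //; exact: sqrtr_ge0. Qed.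

Lemma block_norm_ge0 B (H : forall c, 'M[R]_#|c|) g : 0 <= block_norm B H g.
Proof. exact: bigmax_ge_id. Qed.

End SelectionRules.

(* If r > 1, then 0 <= e k.+1 <= (1 - r) * e k forces e to vanish identically. *)
Lemma contraction_le_expr (R : realFieldType) (r : R) (e : nat -> R) :
  0 < r -> (forall k, 0 <= e k) -> (forall k, e k.+1 <= (1 - r) * e k) ->
  forall k, e k.+1 <= (1 - r) ^+ k * e 0%N.
Proof.
move=> r0 e0 er; have [r1|r1] := lerP r 1.
  (* The exponent lags the index by one, so the base case is [e 1 <= e 0], which follows from
     [0 < r]. *)
  elim=> [|k IH]; first by rewrite expr0 mul1r; have := er 0%N; have := e0 0%N; nra.
  rewrite exprS -mulrA; apply: le_trans (er _) _.
  by apply: ler_wpM2l IH; rewrite subr_ge0.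
have ez k : e k = 0 by have := er k; have := e0 k; have := e0 k.+1; nra.
by move=> k; rewrite !ez mulr0.
Qed.

Theorem corollary2 (R : realType) (n : nat) (f : 'cV[R]_n -> R)
    (B : {set {set 'I_n}}) (H : forall b : {set 'I_n}, 'M[R]_#|b|) (mu : R)
    (x : nat -> 'cV[R]_n) (b : nat -> {set 'I_n})
    (f_diff : forall y : 'cV[R]_n, differentiable f y)
    (f_bounded : has_lbound (range f)%classic)
    (B_blocks : block_collection B)
    (H_posdef : forall c : {set 'I_n}, c \in B -> sym_posdef (H c))
    (f_lip : block_lipschitz B H f)
    (mu_gt0 : 0 < mu)
    (f_PL : PL_inequality B H f mu)
    (x_step : forall k : nat, x k.+1 = bcd_step H f (b k) (x k))
    (b_rule :
      (forall k : nat, GSQ B H (grad f (x k)) (b k))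
      \/ (exists L : {set 'I_n} -> R,
            (forall c : {set 'I_n}, c \in B -> 0 < L c /\ H c = (L c)%:M) /\
            (forall k : nat, GSL B L (grad f (x k)) (b k)))
      \/ (exists D : {set 'I_n} -> 'I_n -> R,
            diag_blocks B D H /\
            (forall k : nat, GSD B D (grad f (x k)) (b k)))
      \/ (exists L : R,
            0 < L /\
            (forall c : {set 'I_n}, c \in B -> H c = L%:M) /\
            (forall k : nat, GS B (grad f (x k)) (b k)))) :
  forall k : nat, f (x k.+1) - optval f <= (1 - mu) ^+ k * (f (x 0%N) - optval f).
Proof.
have ruleQ k : GSQ B H (grad f (x k)) (b k).
  case: b_rule => [|[[L [HL]]|[[D [HD]]|[L [L0 [HL]]]]]] /(_ k) //.
  - exact: GSL_GSQ.
  - exact: GSD_GSQ.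
  - exact: GS_GSQ L0 HL.
apply: (@contraction_le_expr _ mu (fun k => f (x k) - optval f)) => // k.
  by rewrite subr_ge0; apply: ge_inf => //; exists (x k).
have bB : b k \in B by have [] := ruleQ k.
(* The decrease is at least half of [block_norm ^+ 2], hence at least [mu] times the current gap;
   squaring the norm comparison uses [block_norm_ge0]. *)
have := bcd_step_descent f_diff H_posdef f_lip (b k) (x k) bB.
rewrite -x_step; have := f_PL (x k); have := GSQ_block_norm _ _ _ _ (ruleQ k).
have := block_norm_ge0 B H (grad f (x k)); nra.
Qed.
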